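(* Let $\tilde\rho$ be a law-invariant coherent risk measure, and for $j\in\mathcal J$ let the distribution of $\vec X_j$ be $F_j=\sum_{o=1}^{\tau_j}\bar p^j_o\,\mathbf{Dirac}((\vec S_j)_o)$, specified by a pair $(\vec S_j,\bar p^j)\in\mathbb R^{\tau_j}\times\mathbb R^{\tau_j}$. Assume that the set of optimal solutions of the inverse problem $$\inf_{\rho}\ \|\rho-\tilde\rho\|_\infty\quad\text{s.t.}\quad \rho\in\mathcal R_F,\quad \rho(\vec Z^{t}(x^t))\le\rho(\vec Z^t(x))\ \ \forall\,x\in\mathcal X^{t},\ t\in\mathcal T,\quad \rho(\vec L_k)\le\rho(\vec U_k)\ \ \forall k\in\mathcal K$$ is non-empty. Then the problem can be solved by a risk function $\rho^F_\delta\in\mathcal L_F(\{F_j\}_{j\in\mathcal J},\mathcal C_0)$, where $\mathcal L_F(\{F_j\}_{j\in\mathcal J},\mathcal C_0)$ is the set of functions $\rho^F_\delta$, $\delta\in\mathbb R^{|\mathcal J|}$, whose value at a distribution $F_Z=\sum_{o=1}^{\tau}\bar p_o\,\mathbf{Dirac}((\vec S)_o)$ is $$\begin{aligned}\rho^F_\delta(F_Z)=\sup_{p\in\mathbb R^\tau,\,v_j\in\mathbb R^{\tau_j},\,w_j\in\mathbb R^\tau,\,t\in\mathbb R}\quad&p^\top\vec S-t\\ \text{s.t.}\quad&\vec 1^\top v_j+\vec 1^\top w_j\le t+\delta_j,\quad\forall j\in\mathcal J,\\ &\vec S_jp^\top-\Lambda_j\circ(v_j\vec 1^\top)-\vec 1w_j^\top\le0,\quad\forall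 j\in\mathcal J,\\ &p\in\mathcal C_0\subseteq\mathbb R^\tau_+,\end{aligned}$$ with $(\Lambda_j)_{m,n}=\bar p_n/\bar p^j_m$ ($n=1,\dots,\tau$, $m=1,\dots,\tau_j$), and where the parameter $\delta$ is calculated by solving $$\begin{aligned}\min_{\delta,\,y_j,\,v_{i,j},\,w_{i,j}}\quad&\max_{j\in\mathcal J}|\delta_j-\tilde\rho(\vec X_j)|\\ \text{s.t.}\quad&\vec 1^\top v_{i,j}+\vec 1^\top w_{i,j}\le\delta_i-\delta_j+y_j^\top\vec S_j,\quad\forall j\in\mathcal J,\ \forall i\ne j,\\ &\vec S_iy_j^\top-\Lambda_{i,j}\circ(v_{i,j}\vec 1^\top)-\vec 1w_{i,j}^\top\le0,\quad\forall j\in\mathcal J,\ \forall i\ne j,\\ &y_j\in\mathcal C_j\subseteq\mathbb R^{\tau_j}_+,\quad\forall j\in\mathcal J,\\ &y_t^\top\vec S_t\le h_t(y_t),\quad\forall t\in\mathcal T,\\ &\delta_i\le\delta_j,\quad\forall(i,j)\in\mathcal B,\end{aligned}$$ over $\delta\in\mathbb R^{|\mathcal J|}$, $y_j\in\mathbb R^{\tau_j}$, $v_{i,j}\in\mathbb R^{\tau_i}$, $w_{i,j}\in\mathbb R^{\tau_j}$. Here $\vec S_t:=(Z(x^t,\xi^t_1),\dots,Z(x^t,\xi^t_{\tau^t_0}))^\top$ for $t\in\mathcal T$; $\mathcal B:=\{(i,j)\in\mathcal J^2:(\vec X_i,\vec X_j)\in\{(\vec L_k,\vec U_k)\}_{k\in\mathcal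 K}\}$; $h_t(y):=\min_x\{\sum_{o=1}^{\tau^t_0}y_oZ(x,\xi^t_o): x\in\mathcal X^t\}$; and $(\Lambda_{i,j})_{m,n}=\bar p^j_n/\bar p^i_m$ ($n=1,\dots,\tau_j$, $m=1,\dots,\tau_i$). Moreover, with $F_0:=F_Z$ (and $\tau_0:=\tau$, $\bar p^0:=\bar p$), the sets $\mathcal C_j$, $j\in\{0\}\cup\mathcal J$, can be derived from the set $\bar{\bar{\mathcal C}}$ (the support set of $\tilde\rho$ in the case where $\mathbb P$ is uniform) using $$\mathcal C_j=\{y\in\mathbb R^{\tau_j}:\ \mathcal H_{F_j}((\lambda_{F_j})^{-1}\circ y)\in\bar{\bar{\mathcal C}}\},$$ where $\lambda_{F_j}:=(\bar p^j_1|\Omega|,\dots,\bar p^j_{\tau_j}|\Omega|)^\top$, $(\lambda_{F_j})^{-1}\circ\lambda_{F_j}=\vec 1$, and $\mathcal H_{F_j}:\mathbb R^{\tau_j}\to\mathbb R^{|\Omega|}$ replicates each entry $\tilde y_o$ of $\tilde y\in\mathbb R^{\tau_j}$ exactly $\bar p^j_o|\Omega|$ times and concatenates the replications, i.e. $\mathcal H_{F_j}(\tilde y)=(\tilde y_1,\dots,\tilde y_1,\tilde y_2,\dots,\tilde y_2,\dots,\tilde y_{\tau_j},\dots,\tilde y_{\tau_j})^\top$.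
   Context: Setting. All probability distributions of random losses take rational numbers as probability values. Accordingly the random losses are represented on an outcome space $\Omega=\{\omega_i\}_{i=1}^M$ with the uniform probability measure $\mathbb P$, with $M$ such that every probability value appearing is of the form $n/M$, $n\in\{1,\dots,M\}$; a random loss is a vector $\vec Z\in\mathbb R^{|\Omega|}$. For a scalar $c$, $\vec Z+c$ adds $c$ to each entry. $\mathcal R$ is the set of functions $\rho:\mathbb R^{|\Omega|}\to\mathbb R$ with $\rho(\vec 0)=0$ that are monotone ($\vec Z_1\le\vec Z_2$ entrywise implies $\rho(\vec Z_1)\le\rho(\vec Z_2)$), convex, and translation invariant ($\rho(\vec Z+c)=\rho(\vec Z)+c$). $\mathcal R_F\subset\mathcal R$ is the subset of law-invariant functions ($\rho(\vec Z_1)=\rho(\vec Z_2)$ whenever $Z_1,Z_2$ have the same distribution under $\mathbb P$); for $\rho\in\mathcal R_F$ one writes $\rho(F_Z)$ for $\rho(\vec Z)$, $F_Z$ being the distribution of $Z$. A coherent risk measure is a $\rho\in\mathcal R$ with $\rho(\lambda\vec Z)=\lambda\rho(\vec Z)$ for all $\lambda\ge0$; it can be written $\rho(\vec Z)=\sup_{p\in\mathcal C}p^\top\vec Z$ with $\mathcal C$ a non-empty closed convex subset of $\{p\in\mathbb R^{|\Omega|}:\vec 1^\top p=1,\ p\ge0\}$, called its support set. Data: $\mathcal T,\mathcal K$ are finite index sets. For $t\in\mathcal T$: $\mathcal X^t\subseteq\mathbb R^n$ is a convex feasible set, $x^t\in\mathcal X^t$ is an observed decision, and $(\vec Z^t(x))_i=Z(x,\xi^t(\omega_i))$,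 convex in $x$, where $\xi^t:\Omega\to\mathbb R^m$ has finite support $\{\xi^t_1,\dots,\xi^t_{\tau^t_0}\}$ with $\mathbb P(\xi^t=\xi^t_o)=\bar p^{\xi^t}_o$, $o=1,\dots,\tau_0^t$. For $k\in\mathcal K$, $(\vec L_k,\vec U_k)$ is a pair of random losses. $\{\vec X_j\}_{j\in\mathcal J}$ is the finite family consisting of all $\vec Z^t(x^t)$ ($t\in\mathcal T$), $\vec L_k,\vec U_k$ ($k\in\mathcal K$), and $\vec 0$, indexed so that $\mathcal T\subseteq\mathcal J$ and $\vec X_t=\vec Z^t(x^t)$ (so for $t\in\mathcal T$, $\tau_t=\tau^t_0$ and $\bar p^t=\bar p^{\xi^t}$). $\mathbf{Dirac}(a)$ is the point mass at $a$; $\circ$ is the Hadamard product; matrix inequalities are entrywise; $\|\cdot\|_\infty$ is the supremum norm over functions on $\mathbb R^{|\Omega|}$.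
   Formalization: In the program computing δ, the first two constraint families are imposed for all i, j including i = j, and the normalization δ_j = 0 whenever X_j = 0 is added; as printed (i ≠ j only, no normalization) the claim fails. An optimal solution is taken to have finite objective. *)

(* Defs.v *)
(* MathComp / MathComp-Analysis, over an arbitrary R : realType. *)
From HB Require Import structures.
From mathcomp Require Export all_boot all_order all_algebra.
From mathcomp Require Export all_classical all_reals all_analysis.

Set Implicit Arguments.
Unset Strict Implicit.
Unset Printing Implicit Defensive.

Import numFieldNormedType.Exports.

Local Open Scope classical_set_scope.
Local Open Scope ring_scope.

Section Vectors.
Context {R : realType}.

Definition dot n (u v : 'cV[R]_n) : R := \sum_i u i 0 * v i 0.

Definition total n (u : 'cV[R]_n) : R := \sum_i u i 0.

Definition mxle m n (A B : 'M[R]_(m, n)) : Prop := forall i j, A i j <= B i j.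

Definition hadamard m n (A B : 'M[R]_(m, n)) : 'M[R]_(m, n) := map2_mx *%R A B.

End Vectors.

(* The outcome space is 'I_M with the uniform probability; a random loss is a
   column vector indexed by it. *)
Section Laws.
Context {R : realType}.

Definition unif_prob (M : nat) (A : set 'I_M) : R :=
  #|[set i | `[< A i >]]%SET|%:R / M%:R.

Definition law (M : nat) (Z : 'cV[R]_M) : set R -> R :=
  fun B => unif_prob [set i | B (Z i 0)].

(* \sum_o q_o Dirac(S_o); the point mass at a is B |-> \1_B a. *)
Definition dirac_mixture (tau : nat) (S q : 'cV[R]_tau) : set R -> R :=
  fun B => \sum_o q o 0 * \1_B (S o 0).

Definition admissible_prob (M : nat) (a : R) : Prop :=
  exists n : nat, (0 < n <= M)%N /\ a = n%:R / M%:R.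

(* (S, q) specifies the distribution of Z. The atoms listed in S need not be
   pairwise distinct: two outcomes of xi^t may give the same loss at x^t. *)
Definition specifies (M : nat) (Z : 'cV[R]_M) (tau : nat) (S q : 'cV[R]_tau) : Prop :=
  (forall o, admissible_prob M (q o 0)) /\ law Z = dirac_mixture S q.

End Laws.

Section RiskFunctions.
Context {R : realType} (M : nat).
Implicit Types (rho : 'cV[R]_M -> R) (C : set 'cV[R]_M).

Record risk_function rho : Prop := RiskFunction {
  risk_normalized : rho 0 = 0;
  risk_monotone : forall Z1 Z2, mxle Z1 Z2 -> rho Z1 <= rho Z2;
  risk_convex : convex_function setT rho;
  risk_translation : forall Z (c : R), rho (Z + const_mx c) = rho Z + c }.

Definition law_invariant rho : Prop :=
  forall Z1 Z2, law Z1 = law Z2 -> rho Z1 = rho Z2.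

Definition coherent rho : Prop :=
  risk_function rho /\ forall (c : R) Z, 0 <= c -> rho (c *: Z) = c * rho Z.

Definition simplex : set 'cV[R]_M :=
  [set p | total p = 1 /\ forall i, 0 <= p i 0].

Record support_set rho C : Prop := SupportSet {
  support_nonempty : C !=set0;
  support_closed : closed C;
  support_convex : convex_set C;
  support_simplex : C `<=` simplex;
  support_sup : forall Z, (rho Z)%:E = ereal_sup [set (dot p Z)%:E | p in C] }.

Definition sup_dist rho1 rho2 : \bar R :=
  ereal_sup [set `|rho1 Z - rho2 Z|%:E | Z in setT].

End RiskFunctions.

Section SupportTransfer.
Context {R : realType} (M tau : nat).

(* H_F: each entry y_o is repeated q_o * M times (a natural number for the
   weights in use), and the blocks are concatenated. *)
Definition replicate (q y : 'cV[R]_tau) : 'cV[R]_M :=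
  \col_(i < M) nth 0 (flatten
    [seq nseq (Num.truncn (q o 0 * M%:R)) (y o 0) | o <- enum 'I_tau]) i.

Definition lambda_inv (q : 'cV[R]_tau) : 'cV[R]_tau :=
  \col_o (q o 0 * M%:R)^-1.

Definition transferred_support (C : set 'cV[R]_M) (q : 'cV[R]_tau) :
    set 'cV[R]_tau :=
  [set y | C (replicate q (hadamard (lambda_inv q) y))].

End SupportTransfer.

(* The constraint S y^T - Lambda o (v 1^T) - 1 w^T <= 0, with
   Lambda_(m, n) = q_n / qS_m, where qS are the weights of the atoms S and q
   those of the atoms against which y is paired. *)
Definition dual_constraint {R : realType} (a b : nat) (S qS : 'cV[R]_a)
    (y q : 'cV[R]_b) (v : 'cV[R]_a) (w : 'cV[R]_b) : Prop :=
  mxle (S *m y^T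
        - hadamard (\matrix_(m, n) (q n 0 / qS m 0)) (v *m (const_mx 1 : 'cV_b)^T)
        - (const_mx 1 : 'cV_a) *m w^T) 0.

Section RhoF.
Context {R : realType} (M : nat) (J : finType).
Variables (C : set 'cV[R]_M) (tau : J -> nat) (S q : forall j, 'cV[R]_(tau j)).

Definition rhoF_feasible (delta : J -> R) (tau0 : nat) (q0 : 'cV[R]_tau0)
    (p : 'cV[R]_tau0) (v : forall j, 'cV[R]_(tau j)) (w : J -> 'cV[R]_tau0)
    (t : R) : Prop :=
  [/\ forall j, total (v j) + total (w j) <= t + delta j,
      forall j, dual_constraint (S j) (q j) p q0 (v j) (w j)
    & transferred_support C q0 p].

Definition rhoF_value (delta : J -> R) (tau0 : nat) (S0 q0 : 'cV[R]_tau0) : \bar R :=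
  ereal_sup [set a | exists p v w t,
    rhoF_feasible delta q0 p v w t /\ a = (dot p S0 - t)%:E].

(* rho is the law-invariant function rho^F_delta: its value at a loss is the
   value of the above problem for every specification of the distribution of
   that loss (the specification (Z, (1/M, ..., 1/M)) always exists). *)
Definition is_rhoF (delta : J -> R) (rho : 'cV[R]_M -> R) : Prop :=
  forall (Z : 'cV[R]_M) (tau0 : nat) (S0 q0 : 'cV[R]_tau0),
    specifies Z S0 q0 -> (rho Z)%:E = rhoF_value delta S0 q0.

End RhoF.

Definition loss_of {R : realType} (M n m : nat) (Z : 'cV[R]_n -> 'cV[R]_m -> R)
    (xi : 'I_M -> 'cV[R]_m) (x : 'cV[R]_n) : 'cV[R]_M :=
  \col_i Z x (xi i).

Section InverseProblem.
Context {R : realType} (M n m : nat) (T K : finType).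
Variables (X : T -> set 'cV[R]_n) (x : T -> 'cV[R]_n).
Variables (Z : 'cV[R]_n -> 'cV[R]_m -> R) (xi : T -> 'I_M -> 'cV[R]_m).
Variables (L U : K -> 'cV[R]_M) (rho_ref : 'cV[R]_M -> R).

Definition inverse_feasible (rho : 'cV[R]_M -> R) : Prop :=
  [/\ risk_function rho, law_invariant rho,
      forall t u, X t u -> rho (loss_of Z (xi t) (x t)) <= rho (loss_of Z (xi t) u)
    & forall k, rho (L k) <= rho (U k)].

(* The infimum must be a real number: if every feasible rho is at infinite
   distance from rho_ref, the problem has no optimal solution. *)
Definition inverse_optimal (rho : 'cV[R]_M -> R) : Prop :=
  [/\ inverse_feasible rho, (sup_dist rho rho_ref < +oo)%E
    & forall rho', inverse_feasible rho' ->
        (sup_dist rho rho_ref <= sup_dist rho' rho_ref)%E].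

End InverseProblem.

Section Program.
Context {R : realType} (M n m : nat) (T K J : finType).
Variables (X : T -> set 'cV[R]_n) (Z : 'cV[R]_n -> 'cV[R]_m -> R).
Variables (L U : K -> 'cV[R]_M) (rho_ref : 'cV[R]_M -> R) (C : set 'cV[R]_M).
Variables (idx : T -> J) (Xv : J -> 'cV[R]_M).
Variables (tau : J -> nat) (S q : forall j, 'cV[R]_(tau j)).
Variable atom : forall t, 'I_(tau (idx t)) -> 'cV[R]_m.

(* The minimum h_t(y), as an extended real (-oo if unbounded below). *)
Definition h (t : T) (y : 'cV[R]_(tau (idx t))) : \bar R :=
  ereal_inf [set (\sum_o y o 0 * Z u (atom o))%:E | u in X t].

Definition preferred (i j : J) : Prop := exists k, Xv i = L k /\ Xv j = U k.

(* Two points are essential here.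
   - The first two constraints include i = j. For i = j they say that y_j is
     comonotone with S_j, which is not automatic, and without it a minimizer
     delta may give a rho^F_delta that violates the optimality of x^t.
   - The other constraints and rho^F_delta only involve delta up to a common
     additive constant; it is fixed by rho(0) = 0, i.e. delta_j = 0 when
     X_j = 0. *)
Record program_feasible (delta : J -> R) (y : forall j, 'cV[R]_(tau j))
    (v : forall i j : J, 'cV[R]_(tau i)) (w : forall i j : J, 'cV[R]_(tau j)) :
    Prop := ProgramFeasible {
  program_total : forall i j,
    total (v i j) + total (w i j) <= delta i - delta j + dot (y j) (S j);
  program_dual : forall i j,
    dual_constraint (S i) (q i) (y j) (q j) (v i j) (w i j);
  program_support : forall j, transferred_support C (q j) (y j);
  program_decision : forall t,
    ((dot (y (idx t)) (S (idx t)))%:E <= h (y (idx t)))%E;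
  program_preferred : forall i j, preferred i j -> delta i <= delta j;
  program_normalized : forall j, Xv j = 0 -> delta j = 0 }.

Definition program_objective (delta : J -> R) : R :=
  \big[Num.max/0]_j `|delta j - rho_ref (Xv j)|.

Definition program_optimal (delta : J -> R) (y : forall j, 'cV[R]_(tau j))
    (v : forall i j : J, 'cV[R]_(tau i)) (w : forall i j : J, 'cV[R]_(tau j)) :
    Prop :=
  program_feasible delta y v w /\
  forall delta' y' v' w', program_feasible delta' y' v' w' ->
    program_objective delta <= program_objective delta'.

End Program.

(* Main.v *)
Require Import Defs.
From mathcomp Require Import fingroup perm ring lra.

(* Replicating atoms turns every specified law into a vector of R^M, and by the
   duality of the assignment problem the constraints on (v, w) say exactly that
   [<sigma X_i, P> <= c] for all permutations sigma of the outcomes. Hence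
   rho^F_delta is [Z |-> sup_(P in C) <P, Z> - alpha P] with
   [alpha P = max_(i, sigma) <sigma X_i, P> - delta_i], and the constraints of
   the program make [y_j] a subgradient of it at X_j, so that
   rho^F_delta(X_j) = delta_j; its distance to the reference is at most
   [max_j |delta_j - rho_ref X_j|].
   Conversely, a feasible rho at finite distance from rho_ref yields a feasible
   point with delta_j = rho(X_j): the subgradients of rho lie in C by recession,
   they can be averaged over the permutations preserving the atoms, and at X_t
   one of them is minimized over X^t at x^t. So the two problems have the same
   value, and an optimal rho provides a minimizer of the program, without any
   compactness argument. *)

Set Implicit Arguments.
Unset Strict Implicit.
Unset Printing Implicit Defensive.
Import Order.TTheory GRing.Theory Num.Theory.
Import numFieldNormedType.Exports.
Local Open Scope classical_set_scope.
Local Open Scope ring_scope.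

Lemma convex_functionP (R : realType) (E : lmodType R) (D : set E) (f : E -> R) :
  convex_function D f <->
  forall x y (l : R), 0 <= l <= 1 -> D x -> D y ->
    f (l *: x + (1 - l) *: y) <= l * f x + (1 - l) * f y.
Proof.
split=> [cf x y l /andP[l0 l1] Dx Dy|cf t x y xD yD].
  by apply: (cf (Itv01 l0 l1)); exact/mem_set.
apply: (cf x y t%:num); last 2 first; [exact/set_mem | exact/set_mem |].
by rewrite ge0 le1.
Qed.

Lemma convex_setP (R : realType) (E : lmodType R) (D : set E) :
  convex_set D <->
  forall x y (l : R), 0 <= l <= 1 -> D x -> D y -> D (l *: x + (1 - l) *: y).
Proof.
split=> [cD x y l /andP[l0 l1] Dx Dy|cD x y t xD yD]; first exact:
  (set_mem (cD x y (Itv01 l0 l1) (mem_set Dx) (mem_set Dy))).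
by apply/mem_set; apply: (cD x y t%:num); rewrite ?ge0 ?le1//; exact/set_mem.
Qed.

Lemma dotC (R : realType) n (u v : 'cV[R]_n) : dot u v = dot v u.
Proof. by apply: eq_bigr => i _; rewrite mulrC. Qed.

Lemma dotDr (R : realType) n (u v w : 'cV[R]_n) : dot u (v + w) = dot u v + dot u w.
Proof. by rewrite -big_split; apply: eq_bigr => i _; rewrite mxE mulrDr. Qed.

Lemma dotZr (R : realType) n (u v : 'cV[R]_n) c : dot u (c *: v) = c * dot u v.
Proof. by rewrite mulr_sumr; apply: eq_bigr => i _; rewrite mxE mulrCA. Qed.

Lemma dotNr (R : realType) n (u v : 'cV[R]_n) : dot u (- v) = - dot u v.
Proof. by rewrite -scaleN1r dotZr mulN1r. Qed.

Lemma dotBr (R : realType) n (u v w : 'cV[R]_n) : dot u (v - w) = dot u v - dot u w.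
Proof. by rewrite dotDr dotNr. Qed.

Lemma dotDl (R : realType) n (u v w : 'cV[R]_n) : dot (u + v) w = dot u w + dot v w.
Proof. by rewrite dotC dotDr !(dotC w). Qed.

Lemma dotZl (R : realType) n (u v : 'cV[R]_n) c : dot (c *: u) v = c * dot u v.
Proof. by rewrite dotC dotZr dotC. Qed.

Lemma dot0r (R : realType) n (u : 'cV[R]_n) : dot u 0 = 0.
Proof. by apply: big1 => i _; rewrite mxE mulr0. Qed.

Lemma dot_delta (R : realType) n (u : 'cV[R]_n) i : dot u (delta_mx i 0) = u i 0.
Proof.
rewrite /dot (bigD1 i)//= big1 => [|k /negPf ki]; last by rewrite mxE ki mulr0.
by rewrite mxE !eqxx mulr1 addr0.
Qed.

Lemma dot_const (R : realType) n (u : 'cV[R]_n) c : dot u (const_mx c) = total u * c.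
Proof. by rewrite mulr_suml; apply: eq_bigr => i _; rewrite mxE. Qed.

(* The finite-dimensional Hahn-Banach theorem, with the linear form extended
   one coordinate at a time. *)
Lemma convex_linear_minorant (R : realType) n (F : 'cV[R]_n -> R) :
  convex_function setT F -> F 0 = 0 ->
  exists p : 'cV[R]_n, forall V, dot p V <= F V.
Proof.
move=> /convex_functionP cF F0.
suff H k : exists p : 'cV[R]_n,
    forall V : 'cV[R]_n, (forall i : 'I_n, (k <= i)%N -> V i 0 = 0) -> dot p V <= F V.
  have [p pF] := H n; exists p => V; apply: pF => i.
  by rewrite leqNgt ltn_ord.
elim: k => [|k [p pF]].
  exists 0 => V V0; have -> : V = 0; last by rewrite dot0r F0.
  by apply/matrixP => i j; rewrite mxE (ord1 j) V0.
have [kn|nk] := ltnP k n; last first.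
  exists p => V V0; apply: pF => i ki.
  by have := leq_trans (ltn_ord i) (leq_trans nk ki); rewrite ltnn.
pose o := Ordinal kn; pose e : 'cV[R]_n := delta_mx o 0.
pose low (V : 'cV[R]_n) := forall i : 'I_n, (k <= i)%N -> V i 0 = 0.
have key V W s r : low V -> low W -> 0 < s -> 0 < r ->
    (dot p V - F (V - s *: e)) / s <= (F (W + r *: e) - dot p W) / r.
  move=> lV lW s0 r0; have sr0 : 0 < r + s by rewrite addr_gt0.
  have E : 1 - r / (r + s) = s / (r + s) by field; rewrite gt_eqF.
  have l01 : 0 <= r / (r + s) <= 1.
    by rewrite divr_ge0 ?(ltW r0) ?(ltW sr0)//= ler_pdivrMr// mul1r lerDl ltW.
  have := cF (V - s *: e) (W + r *: e) _ l01 I I.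
  have -> : (r / (r + s)) *: (V - s *: e) + (1 - r / (r + s)) *: (W + r *: e)
     = (r / (r + s)) *: V + (1 - r / (r + s)) *: W.
    by apply/matrixP => i j; rewrite E !mxE; field; rewrite gt_eqF.
  have := pF ((r / (r + s)) *: V + (1 - r / (r + s)) *: W).
  rewrite dotDr !dotZr E => /(_ _)/le_trans /[apply].
  have lVW : forall i : 'I_n, (k <= i)%N ->
      (r / (r + s) *: V + s / (r + s) *: W) i 0 = 0.
    by move=> i ki; rewrite !mxE lV// lW// !mulr0 addr0.
  move=> /(_ lVW); rewrite ![_ / (r + s) * _]mulrAC -!mulrDl.
  rewrite ler_pM2r ?invr_gt0// => h.
  by rewrite ler_pdivrMr// mulrAC ler_pdivlMr//; lra.
have l0 : low 0 by move=> i _; rewrite mxE.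
pose A := [set a | exists V s, [/\ low V, 0 < s & a = (dot p V - F (V - s *: e)) / s]].
have supA : has_sup A.
  split; first by exists ((dot p 0 - F (0 - 1 *: e)) / 1), 0, 1; split.
  exists ((F (0 + 1 *: e) - dot p 0) / 1) => _ [V [s [lV s0 ->]]].
  exact: key.
pose c := sup A.
exists (p + (c - p o 0) *: e) => V V0.
pose V' := V - V o 0 *: e.
have lV' : low V'.
  move=> i; rewrite leq_eqVlt => /predU1P[ki|ki].
    have -> : i = o by exact/val_inj.
    by rewrite !mxE !eqxx mulr1 subrr.
  have io : (i == o) = false by apply: gtn_eqF.
  by rewrite !mxE io /= mulr0 subr0 V0.
have VE : V = V' + V o 0 *: e by rewrite subrK.
have -> : dot (p + (c - p o 0) *: e) V = dot p V' + c * V o 0.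
  rewrite dotDl dotZl [dot e _]dotC dot_delta {1}VE dotDr dotZr dot_delta; ring.
have [v0|v0|v0] := ltgtP (V o 0) 0.
- have : A ((dot p V' - F (V' - (- V o 0) *: e)) / (- V o 0)).
    by exists V', (- V o 0); split => //; rewrite oppr_gt0.
  move=> /(sup_upper_bound supA); rewrite scaleNr opprK -VE -/c.
  by rewrite ler_pdivrMr ?oppr_gt0// mulrN; lra.
- have : c <= (F (V' + V o 0 *: e) - dot p V') / V o 0.
    apply: ge_sup; first exact: supA.1.
    by move=> _ [W [s [lW s0 ->]]]; exact: key.
  by rewrite -VE ler_pdivlMr//; lra.
- rewrite v0 mulr0 addr0 (_ : V = V'); first exact: pF.
  by rewrite {1}VE v0 scale0r addr0.
Qed.

(* Otherwise a subgradient at p of the distance to C strictly separates p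
   from C. *)
Lemma support_setP (R : realType) M (rho : 'cV[R]_M -> R) (C : set 'cV[R]_M) :
  support_set rho C -> forall p, C p <-> forall Z, dot p Z <= rho Z.
Proof.
move=> [[c0 Cc0] Ccl /convex_setP Ccvx _ Csup] p; split=> [Cp Z|pC].
  by rewrite -lee_fin Csup; apply: ereal_sup_ubound; exists p.
apply: contrapT => nCp.
have [e e0 eC] : exists2 e : R, 0 < e & forall c, C c -> e <= `|p - c|.
  have /nbhs_normP[e /= e0 eC] : nbhs p (~` C).
    by apply: open_nbhs_nbhs; split => //; exact: closed_openC.
  by exists e => // c Cc; rewrite leNgt; apply/negP => ce; exact: (eC c).
pose A V := [set `|V - c| | c in C].
have infA V : has_inf (A V).
  by split; [exists `|V - c0|, c0 | exists 0 => _ [c _ <-]].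
pose F V := inf (A (p + V)) - inf (A p).
have [z zF] : exists z : 'cV[R]_M, forall V, dot z V <= F V.
  apply: convex_linear_minorant; last by rewrite /F addr0 subrr.
  apply/convex_functionP => V W l /andP[l0 l1] _ _.
  suff : inf (A (p + (l *: V + (1 - l) *: W))) <=
      l * inf (A (p + V)) + (1 - l) * inf (A (p + W)) by rewrite /F; lra.
  apply/ler_addgt0Pr => d d0.
  have [_ [a Ca <-] /ltW ha] := inf_adherent d0 (infA (p + V)).
  have [_ [b Cb <-] /ltW hb] := inf_adherent d0 (infA (p + W)).
  have Cab : C (l *: a + (1 - l) *: b) by apply: Ccvx => //; rewrite l0.
  have /le_trans -> // : inf (A (p + (l *: V + (1 - l) *: W))) <=
     `|p + (l *: V + (1 - l) *: W) - (l *: a + (1 - l) *: b)|.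
    by apply: ge_inf; [exact: (infA _).2 | exists (l *: a + (1 - l) *: b)].
  have -> : p + (l *: V + (1 - l) *: W) - (l *: a + (1 - l) *: b) =
     l *: (p + V - a) + (1 - l) *: (p + W - b).
    by apply/matrixP => i j; rewrite !mxE; ring.
  rewrite (le_trans (ler_normD _ _))// !normrZ !ger0_norm ?subr_ge0//.
  have := ler_wpM2l l0 ha.
  have l1' : 0 <= 1 - l by lra.
  have := ler_wpM2l l1' hb.
  by lra.
have zC c : C c -> dot c z <= dot p z - e.
  move=> Cc; have := zF (c - p); rewrite /F [p + _]addrC subrK dotBr !(dotC z).
  have : inf (A c) <= 0.
    apply: ge_inf; first exact: (infA _).2.
    by exists c => //; rewrite subrr normr0.
  have : e <= inf (A p).
    by apply: lb_le_inf; [exact: (infA _).1 | move=> _ [b Cb <-]; exact: eC].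
  by lra.
have : rho z <= dot p z - e.
  by rewrite -lee_fin Csup; apply: ge_ereal_sup => _ [c Cc <-]; rewrite lee_fin zC.
by have := pC z; lra.
Qed.

Record block_map (R : realType) M tau (q : 'cV[R]_tau) (b : 'I_M -> 'I_tau) : Prop := {
  block_gt0 : forall o, 0 < q o 0;
  block_card : forall o, #|[set i | b i == o]%SET|%:R = q o 0 * M%:R;
  block_replicate : forall y, replicate M q y = \col_i y (b i) 0 }.

Lemma specifies_block_map (R : realType) M tau (Z : 'cV[R]_M) (S q : 'cV[R]_tau) :
  (0 < M)%N -> specifies Z S q -> exists b : 'I_M -> 'I_tau, block_map q b.
Proof.
move=> M0 [adm lawZ].
have MR : M%:R != 0 :> R by rewrite pnatr_eq0 -lt0n.
pose k o := Num.truncn (q o 0 * M%:R).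
have kE o : (k o)%:R = q o 0 * M%:R.
  by rewrite /k; have [n [_ ->]] := adm o; rewrite divfK// natrK.
have q0 o : 0 < q o 0.
  by have [n [/andP[n0 _] ->]] := adm o; rewrite divr_gt0// ltr0n.
have sumq : \sum_o q o 0 = 1.
  have := congr1 (fun f => f setT) lawZ.
  rewrite /law /unif_prob /dirac_mixture => /esym.
  rewrite (_ : [set _ | _]%SET = [set: 'I_M]%SET); last first.
    by apply/setP => i; rewrite !inE; apply/asboolP.
  rewrite cardsT card_ord divff// => <-.
  by apply: eq_bigr => o _; rewrite indicT mulr1.
have sumk : (\sum_o k o = M)%N.
  apply/eqP; rewrite -(eqr_nat R) natr_sum; apply/eqP.
  by under eq_bigr do rewrite kE; rewrite -mulr_suml sumq mul1r.
pose s := flatten [seq nseq (k o) o | o <- enum 'I_tau].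
have sizes : size s = M.
  rewrite size_flatten /shape -map_comp -[RHS]sumk sumnE big_map big_enum /=.
  by apply: eq_bigr => o _; rewrite size_nseq.
have o0 : 'I_tau by move: sizes M0; case: (s) => [<-|o _ _ _].
exists (fun i => nth o0 s i); split => [|o|y].
- exact: q0.
- rewrite -kE; congr (_%:R); transitivity (count_mem o s).
    rewrite -sum1_count (big_nth o0) sizes big_mkord -sum1_card.
    by apply: eq_bigl => i; rewrite inE.
  rewrite count_flatten -map_comp sumnE big_map big_enum /= (bigD1 o)//=.
  rewrite count_nseq /= eqxx mul1n big1 ?addn0// => i /negPf io.
  by rewrite count_nseq /= io.
- apply/matrixP => i j; rewrite !mxE -(nth_map _ 0 (fun o => y o 0)) ?sizes//.
  rewrite map_flatten -map_comp; congr (nth _ (flatten _) _).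
  by apply: eq_map => o /=; rewrite map_nseq.
Qed.

Lemma sum_block (R : realType) M tau (q : 'cV[R]_tau) (b : 'I_M -> 'I_tau)
    (G : 'I_tau -> R) : block_map q b ->
  \sum_i G (b i) = \sum_o q o 0 * M%:R * G o.
Proof.
move=> [_ bc _]; rewrite (partition_big b xpredT)//=; apply: eq_bigr => o _.
rewrite (eq_bigr (fun=> G o)) => [|i /eqP-> //].
rewrite sumr_const -bc mulr_natl; congr (_ *+ _).
by apply: eq_card => i; rewrite !inE.
Qed.

Lemma law_replicate (R : realType) M tau (S q : 'cV[R]_tau) (b : 'I_M -> 'I_tau) :
  (0 < M)%N -> block_map q b -> law (replicate M q S) = dirac_mixture S q.
Proof.
move=> M0 bq; have MR : M%:R != 0 :> R by rewrite pnatr_eq0 -lt0n.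
apply/funext => B; rewrite /law /unif_prob /dirac_mixture.
rewrite -sum1_card natr_sum big_mkcond/=.
rewrite (eq_bigr (fun i => \1_B (S (b i) 0))); last first.
  move=> i _; rewrite inE (block_replicate bq) indicE.
  by case: asboolP => /= [|]; rewrite mxE => Bi; rewrite ?(mem_set Bi) ?(memNset Bi).
rewrite (sum_block (fun o => \1_B (S o 0)) bq) mulr_suml.
by apply: eq_bigr => o _; field.
Qed.

Lemma law_row_perm (R : realType) M (s : 'S_M) (Z : 'cV[R]_M) :
  law (row_perm s Z) = law Z.
Proof.
apply/funext => B; rewrite /law /unif_prob; congr (_%:R / _).
rewrite -(card_imset _ (@perm_inj _ s)); apply: eq_card => i; rewrite inE.
apply/imsetP/asboolP => [[k + ->]|Bi]; first by rewrite inE => /asboolP; rewrite /= mxE.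
by exists ((s^-1)%g i); rewrite ?permKV// inE; apply/asboolP; rewrite /= mxE permKV.
Qed.

Lemma law_eq_row_perm (R : realType) M (Z1 Z2 : 'cV[R]_M) : (0 < M)%N ->
  law Z1 = law Z2 -> exists s : 'S_M, Z1 = row_perm s Z2.
Proof.
move=> M0 e; have MR : M%:R != 0 :> R by rewrite pnatr_eq0 -lt0n.
pose t (Z : 'cV[R]_M) := [tuple Z i 0 | i < M].
have cnt (Z : 'cV[R]_M) (a : pred R) :
    law Z [set x | a x] = (count a (t Z))%:R / M%:R.
  rewrite /law /unif_prob; congr (_%:R / _).
  rewrite /= count_map -sum1_count enumT -sum1_card [index_enum _]unlock.
  by apply: eq_bigl => i; rewrite inE; apply/asboolP/idP.
have : perm_eq (t Z1) (t Z2).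
  apply/seq.permP => a; apply/eqP; rewrite -(eqr_nat R); apply/eqP.
  by apply: (mulIf (x := M%:R^-1)); rewrite ?invr_eq0// -!cnt e.
move=> /tuple_permP[s sE]; exists s; apply/matrixP => i j; rewrite (ord1 j) mxE.
have := congr1 (fun u => nth 0 u i) sE.
rewrite -!tnth_nth => /=.
by rewrite !tnth_mktuple => ->.
Qed.

Lemma sorting_perm (R : realType) M (a : 'I_M -> R) :
  exists s : 'S_M, forall i k : 'I_M, (i <= k)%N -> a (s i) <= a (s k).
Proof.
pose t := [tuple a i | i < M].
have /tuple_permP[s sE] : perm_eq (sort <=%R t) t by rewrite perm_sort.
have sz : size (sort <=%R t) = M by rewrite size_sort size_tuple.
have nthE (i : 'I_M) : nth 0 (sort <=%R t) i = a (s i).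
  by rewrite sE -tnth_nth !tnth_mktuple.
exists s => i k ik; rewrite -!nthE.
by apply: (sorted_leq_nth le_trans le_refl); rewrite ?inE ?sz ?ltn_ord// sort_le_sorted.
Qed.

(* After sorting both families the potentials telescope:
   [w_n = \sum_(l < n) a_l (b_(l+1) - b_l)] and [v_n = a_n b_n - w_n]. *)
Lemma assignment_duality (R : realType) M (a b : 'I_M -> R) (c : R) :
  (forall s : 'S_M, \sum_i a (s i) * b i <= c) ->
  exists v w : 'I_M -> R,
    (forall i k, a i * b k <= v i + w k) /\ \sum_i v i + \sum_i w i <= c.
Proof.
case: M a b => [|M] a b abc.
  by exists a, b; split => [[]//|]; have := abc 1%g; rewrite !big_ord0 addr0.
have [sa saP] := sorting_perm a; have [sb sbP] := sorting_perm b.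
pose A n := a (sa (inord (minn n M))); pose B n := b (sb (inord (minn n M))).
have mono n n' : (n <= n')%N ->
    ((inord (minn n M) : 'I_M.+1) <= (inord (minn n' M) : 'I_M.+1))%N.
  by move=> nn'; rewrite !inordK ?ltnS ?geq_minr// leq_min geq_minr geq_min nn'.
have Amono n n' : (n <= n')%N -> A n <= A n' by move=> nn'; exact/saP/mono.
have Bmono n n' : (n <= n')%N -> B n <= B n' by move=> nn'; exact/sbP/mono.
pose w n := \sum_(0 <= l < n) A l * (B l.+1 - B l).
have wB k d : A k * (B (k + d)%N - B k) <= w (k + d)%N - w k /\
    w (k + d)%N - w k <= A (k + d)%N * (B (k + d)%N - B k).
  elim: d => [|d [h1 h2]]; first by rewrite addn0 !subrr mulr0.
  rewrite addnS {1 3}/w big_nat_recr//= -/(w _).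
  have A1 : A k <= A (k + d)%N by apply: Amono; rewrite leq_addr.
  have A2 : A (k + d)%N <= A (k + d).+1 by exact: Amono.
  have B1 : 0 <= B (k + d).+1 - B (k + d)%N by rewrite subr_ge0 Bmono.
  have B2 : 0 <= B (k + d)%N - B k by rewrite subr_ge0 Bmono// leq_addr.
  have := ler_wpM2r B1 A1; have := ler_wpM2r B1 A2; have := ler_wpM2r B2 A2.
  by split; lra.
have key k l : A k * B l <= (A k * B k - w k) + w l.
  have [kl|/ltnW lk] := leqP k l.
    by have [+ _] := wB k (l - k)%N; rewrite subnKC//; lra.
  by have [_ +] := wB l (k - l)%N; rewrite subnKC//; lra.
have clip (i : 'I_M.+1) : inord (minn i M) = i :> 'I_M.+1.
  by rewrite (minn_idPl _) ?inord_val// -ltnS.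
pose v n := A n * B n - w n.
exists (fun i => v ((sa^-1)%g i)), (fun k => w ((sb^-1)%g k)); split => [i k|].
  have := key ((sa^-1)%g i) ((sb^-1)%g k).
  by rewrite {1}/A {1}/B !clip !permKV.
apply: le_trans (abc (sb^-1 * sa)%g).
rewrite (reindex_inj (@perm_inj _ sa)) [X in _ + X](reindex_inj (@perm_inj _ sb)).
rewrite [leRHS](reindex_inj (@perm_inj _ sb)) -big_split/=.
apply: ler_sum => i _; rewrite !permK permM permK /v subrK.
by rewrite /A /B !clip.
Qed.

Lemma dual_constraintP (R : realType) a b (S qS : 'cV[R]_a) (y q : 'cV[R]_b) v w :
  dual_constraint S qS y q v w <->
  forall m n, S m 0 * y n 0 <= q n 0 / qS m 0 * v m 0 + w n 0.
Proof.
split=> h m n.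
  by have := h m n; rewrite !mxE !big_ord1 !mxE mulr1 mul1r; lra.
by rewrite !mxE !big_ord1 !mxE mulr1 mul1r; have := h m n; lra.
Qed.

(* Strong duality for optimal transport between the two laws. *)
Lemma dual_constraint_row_perm (R : realType) M a b (S qS : 'cV[R]_a)
    (y q : 'cV[R]_b) (bS : 'I_M -> 'I_a) (bq : 'I_M -> 'I_b) (c : R) :
  (0 < M)%N -> block_map qS bS -> block_map q bq ->
  (exists v w, dual_constraint S qS y q v w /\ total v + total w <= c) <->
  forall s : 'S_M, dot (row_perm s (replicate M qS S))
    (replicate M q (hadamard (lambda_inv M q) y)) <= c.
Proof.
move=> M0 hS hq.
have MR : M%:R != 0 :> R by rewrite pnatr_eq0 -lt0n.
have MR0 : 0 < M%:R :> R by rewrite ltr0n.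
have qS0 := block_gt0 hS; have q0 := block_gt0 hq.
have dotE s : dot (row_perm s (replicate M qS S))
    (replicate M q (hadamard (lambda_inv M q) y)) =
    \sum_i S (bS (s i)) 0 * (y (bq i) 0 / (q (bq i) 0 * M%:R)).
  apply: eq_bigr => i _; rewrite mxE (block_replicate hS) (block_replicate hq).
  by rewrite !mxE [_^-1 * _]mulrC.
split=> [[v [w [/dual_constraintP h vw]]] s|h].
  rewrite dotE; apply: le_trans vw.
  have -> : total v + total w =
      \sum_i (v (bS (s i)) 0 / (qS (bS (s i)) 0 * M%:R) +
              w (bq i) 0 / (q (bq i) 0 * M%:R)).
    rewrite big_split/=; congr (_ + _).
      transitivity (\sum_i v (bS i) 0 / (qS (bS i) 0 * M%:R)); last first.
        exact: reindex_inj (@perm_inj _ s).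
      rewrite (sum_block (fun o => v o 0 / (qS o 0 * M%:R)) hS).
      by apply: eq_bigr => o _; field; rewrite MR gt_eqF.
    rewrite (sum_block (fun o => w o 0 / (q o 0 * M%:R)) hq).
    by apply: eq_bigr => o _; field; rewrite MR gt_eqF.
  apply: ler_sum => i _.
  have q0' : 0 < q (bq i) 0 * M%:R by rewrite mulr_gt0.
  rewrite mulrA ler_pdivrMr// mulrDl divfK ?gt_eqF//.
  apply: le_trans (h (bS (s i)) (bq i)) _.
  by rewrite lerD2r le_eqVlt; apply/orP; left; apply/eqP; field; rewrite MR gt_eqF.
have [s|v [w [vw sc]]] := @assignment_duality _ _
    (fun i => S (bS i) 0) (fun i => y (bq i) 0 / (q (bq i) 0 * M%:R)) c.
  by rewrite -dotE.
pose v' : 'cV[R]_a := \col_m \sum_(i | bS i == m) v i.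
pose w' : 'cV[R]_b := \col_n \sum_(i | bq i == n) w i.
exists v', w'; split; last first.
  rewrite (le_trans _ sc)// le_eqVlt; apply/orP; left; apply/eqP; congr (_ + _).
    rewrite [RHS](partition_big bS xpredT)//=.
    by apply: eq_bigr => m _; rewrite mxE.
  rewrite [RHS](partition_big bq xpredT)//=.
  by apply: eq_bigr => m _; rewrite mxE.
apply/dual_constraintP => m n.
have card_sum a' (q' : 'cV[R]_a') (b' : 'I_M -> 'I_a') (hb : block_map q' b') o (d : R) :
    \sum_(i | b' i == o) d = q' o 0 * M%:R * d.
  rewrite sumr_const -(block_card hb) mulr_natl; congr (_ *+ _).
  by apply: eq_card => i; rewrite !inE.
have : \sum_(i | bS i == m) \sum_(k | bq k == n)
      S (bS i) 0 * (y (bq k) 0 / (q (bq k) 0 * M%:R)) <=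
    \sum_(i | bS i == m) \sum_(k | bq k == n) (v i + w k).
  by apply: ler_sum => i _; apply: ler_sum => k _; exact: vw.
have -> : \sum_(i | bS i == m) \sum_(k | bq k == n)
      S (bS i) 0 * (y (bq k) 0 / (q (bq k) 0 * M%:R)) =
    (S m 0 * y n 0) * (qS m 0 * M%:R).
  transitivity (\sum_(i | bS i == m) S m 0 * y n 0).
    apply: eq_bigr => i /eqP ->.
    transitivity (\sum_(k | bq k == n) S m 0 * (y n 0 / (q n 0 * M%:R))).
      by apply: eq_bigr => k /eqP ->.
    by rewrite (card_sum _ _ _ hq); field; rewrite MR gt_eqF.
  by rewrite (card_sum _ _ _ hS); ring.
have -> : \sum_(i | bS i == m) \sum_(k | bq k == n) (v i + w k) =
    (q n 0 / qS m 0 * v' m 0 + w' n 0) * (qS m 0 * M%:R).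
  transitivity (\sum_(i | bS i == m) (q n 0 * M%:R * v i + w' n 0)).
    by apply: eq_bigr => i _; rewrite big_split/= (card_sum _ _ _ hq) mxE.
  rewrite big_split/= (card_sum _ _ _ hS) -mulr_sumr [v' m 0]mxE.
  by field; rewrite gt_eqF.
by rewrite ler_pM2r// mulr_gt0.
Qed.

Lemma dot_row_perm (R : realType) M (s : 'S_M) (u v : 'cV[R]_M) :
  dot (row_perm s u) v = dot u (row_perm s^-1%g v).
Proof.
rewrite /dot [RHS](reindex_inj (@perm_inj _ s)); apply: eq_bigr => i _.
by rewrite !mxE permK.
Qed.

Lemma dot_replicate (R : realType) M tau (q y S : 'cV[R]_tau) (b : 'I_M -> 'I_tau) :
  (0 < M)%N -> block_map q b ->
  dot (replicate M q (hadamard (lambda_inv M q) y)) (replicate M q S) = dot y S.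
Proof.
move=> M0 hb; have MR : M%:R != 0 :> R by rewrite pnatr_eq0 -lt0n.
transitivity (\sum_i y (b i) 0 * (q (b i) 0 * M%:R)^-1 * S (b i) 0).
  apply: eq_bigr => i _; rewrite !(block_replicate hb) !mxE.
  by rewrite [_^-1 * _]mulrC.
rewrite (sum_block (fun o => y o 0 * (q o 0 * M%:R)^-1 * S o 0) hb).
by apply: eq_bigr => o _; field; rewrite MR gt_eqF// (block_gt0 hb).
Qed.

Lemma block_constant_replicate (R : realType) M tau (q : 'cV[R]_tau)
    (b : 'I_M -> 'I_tau) (P : 'cV[R]_M) : (0 < M)%N -> block_map q b ->
  (forall i k, b i = b k -> P i 0 = P k 0) ->
  exists y, replicate M q (hadamard (lambda_inv M q) y) = P.
Proof.
move=> M0 hb Pb; have MR : M%:R != 0 :> R by rewrite pnatr_eq0 -lt0n.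
exists (\col_o \sum_(k | b k == o) P k 0).
apply/matrixP => i j; rewrite (ord1 j) (block_replicate hb) !mxE.
rewrite (eq_bigr (fun=> P i 0)) => [|k /eqP]; last exact: Pb.
rewrite sumr_const.
have -> : #|[pred k | b k == b i]| = #|[set k | b k == b i]%SET|.
  by apply: eq_card => k; rewrite !inE.
rewrite -[P i 0 *+ _]mulr_natl (block_card hb) mulKf// mulf_neq0// gt_eqF//.
exact: block_gt0 hb _.
Qed.

Lemma block_average (R : realType) M tau (b : 'I_M -> 'I_tau) (P : 'cV[R]_M) :
  exists P' : 'cV[R]_M, (forall i k, b i = b k -> P' i 0 = P' k 0) /\
    forall Z c, (forall s : 'S_M, (forall i, b (s i) = b i) ->
      dot P (row_perm s Z) <= c) -> dot P' Z <= c.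
Proof.
pose G := [set s : 'S_M | [forall i, b (s i) == b i]]%SET.
have GP (s : 'S_M) : reflect (forall i, b (s i) = b i) (s \in G).
  by rewrite inE; apply: (iffP forallP) => h i; apply/eqP.
have G0 : 0 < #|G|%:R :> R.
  by rewrite ltr0n card_gt0; apply/set0Pn; exists 1%g; apply/GP => i; rewrite perm1.
exists (#|G|%:R^-1 *: \sum_(s in G) row_perm s P); split=> [i k bik|Z c h].
  rewrite !mxE !summxE; congr (_ * _).
  pose r := tperm i k.
  have Gr (s : 'S_M) : (r * s \in G)%g = (s \in G).
    have br l : b (r l) = b l by rewrite /r; case: tpermP => // ->.
    apply/GP/GP => h l; last by rewrite permM h br.
    by rewrite -(br l) -(h (r l)) permM /r tpermK.
  rewrite (reindex_inj (mulgI r)); apply: eq_big => [s|s _]; first by rewrite Gr.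
  by rewrite !mxE permM /r tpermL.
rewrite dotZl mulrC ler_pdivrMr//.
have -> : dot (\sum_(s in G) row_perm s P) Z = \sum_(s in G) dot (row_perm s P) Z.
  apply: (big_morph (fun u => dot u Z)); first by move=> u v; rewrite dotDl.
  by rewrite dotC dot0r.
rewrite mulr_natr -sumr_const; apply: ler_sum => s /GP sb.
by rewrite dot_row_perm h// => i; rewrite -{2}(permKV s i) sb.
Qed.

Section Penalized.
Context {R : realType} {M : nat} {J : finType}.
Variables (rho_ref : 'cV[R]_M -> R) (C : set 'cV[R]_M).
Variables (A : J -> 'cV[R]_M) (delta : J -> R).

Definition penalty_feasible (P : 'cV[R]_M) (t : R) : Prop :=
  C P /\ forall j (s : 'S_M), dot (row_perm s (A j)) P <= t + delta j.

Definition penalized_values (Z : 'cV[R]_M) : set R :=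
  [set a | exists P t, penalty_feasible P t /\ a = dot P Z - t].

Definition penalized (Z : 'cV[R]_M) : R := sup (penalized_values Z).

Hypotheses (M_gt0 : (0 < M)%N) (rho_ref_law : law_invariant rho_ref).
Hypothesis C_support : support_set rho_ref C.

Lemma support_row_perm P (s : 'S_M) : C P -> C (row_perm s P).
Proof.
move=> /(support_setP C_support) CP; apply/(support_setP C_support) => Z.
by rewrite dot_row_perm (le_trans (CP _))// (rho_ref_law (law_row_perm _ _)).
Qed.

Lemma penalty_feasible_row_perm P t (s : 'S_M) :
  penalty_feasible P t -> penalty_feasible (row_perm s P) t.
Proof.
move=> [CP Pt]; split=> [|j r]; first exact: support_row_perm.
by rewrite dotC dot_row_perm dotC -row_permM Pt.
Qed.

Lemma penalty_feasible_block_average tau (b : 'I_M -> 'I_tau) P t :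
  penalty_feasible P t -> exists P', [/\ penalty_feasible P' t,
    forall i k, b i = b k -> P' i 0 = P' k 0 &
    forall S : 'cV[R]_tau,
      dot P' (\col_i S (b i) 0) = dot P (\col_i S (b i) 0)].
Proof.
move=> [CP Pt]; have [P' [P'b P'le]] := block_average b P.
exists P'; split => //; first split.
- apply/(support_setP C_support) => Z; apply: P'le => s _.
  rewrite (le_trans ((support_setP C_support P).1 CP _))//.
  by rewrite (rho_ref_law (law_row_perm _ _)).
- by move=> j s; rewrite dotC; apply: P'le => r _; rewrite dotC -row_permM.
- have le S c : dot P (\col_i S (b i) 0) <= c -> dot P' (\col_i S (b i) 0) <= c.
    move=> h; apply: P'le => s sb; rewrite (_ : row_perm _ _ = \col_i S (b i) 0)//.
    by apply/matrixP => i j; rewrite !mxE sb.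
  move=> S; apply/eqP; rewrite eq_le le//=.
  rewrite -lerN2 -!dotNr (_ : - _ = \col_i (- S) (b i) 0); first exact: le.
  by apply/matrixP => i j; rewrite !mxE.
Qed.

Hypothesis ref_risk : risk_function rho_ref.
Variables (j0 : J) (P0 : 'cV[R]_M).
Hypotheses (A_j0 : A j0 = 0) (delta_j0 : delta j0 = 0).
Hypothesis P0_feasible : penalty_feasible P0 0.

Lemma penalty_ge0 P t : penalty_feasible P t -> 0 <= t.
Proof.
move=> [_ /(_ j0 1%g)]; rewrite A_j0 delta_j0 addr0 row_perm1.
by rewrite dotC dot0r.
Qed.

Lemma has_sup_penalized Z : has_sup (penalized_values Z).
Proof.
split; first by exists (dot P0 Z - 0), P0, 0.
exists (rho_ref Z) => _ [P [t [Pt ->]]]; have := penalty_ge0 Pt.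
by have := (support_setP C_support P).1 Pt.1 Z; lra.
Qed.

Lemma le_penalized P t Z : penalty_feasible P t -> dot P Z - t <= penalized Z.
Proof. by move=> Pt; apply: sup_upper_bound (has_sup_penalized Z) _ _; exists P, t. Qed.

Lemma penalized_le Z c :
  (forall P t, penalty_feasible P t -> dot P Z - t <= c) -> penalized Z <= c.
Proof.
move=> h; apply: ge_sup; first exact: (has_sup_penalized Z).1.
by move=> _ [P [t [Pt ->]]]; exact: h.
Qed.

Lemma penalized_risk_function : risk_function penalized.
Proof.
split.
- apply/eqP; rewrite eq_le; apply/andP; split.
    by apply: penalized_le => P t /penalty_ge0; rewrite dot0r; lra.
  by have := le_penalized 0 P0_feasible; rewrite dot0r subr0.
- move=> Z1 Z2 Z12; apply: penalized_le => P t Pt.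
  rewrite (le_trans _ (le_penalized _ Pt))// lerD2r; apply: ler_sum => i _.
  by rewrite ler_wpM2l//; exact: (support_simplex C_support Pt.1).2.
- apply/convex_functionP => Z1 Z2 l /andP[l0 l1] _ _.
  apply: penalized_le => P t Pt; rewrite dotDr !dotZr.
  have l1' : 0 <= 1 - l by lra.
  have := ler_wpM2l l0 (le_penalized Z1 Pt).
  by have := ler_wpM2l l1' (le_penalized Z2 Pt); lra.
- have tr P Z c : C P -> dot P (Z + const_mx c) = dot P Z + c.
    by move=> /(support_simplex C_support)[P1 _]; rewrite dotDr dot_const P1 mul1r.
  move=> Z c; apply/eqP; rewrite eq_le; apply/andP; split.
    apply: penalized_le => P t Pt; rewrite tr; last exact: Pt.1.
    by have := le_penalized Z Pt; lra.
  rewrite -lerBrDr; apply: penalized_le => P t Pt.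
  by have := le_penalized (Z + const_mx c) Pt; rewrite tr; [lra | exact: Pt.1].
Qed.

Lemma penalized_law_invariant : law_invariant penalized.
Proof.
have le Z1 Z2 : law Z1 = law Z2 -> penalized Z1 <= penalized Z2.
  move=> /(law_eq_row_perm M_gt0)[s ->]; apply: penalized_le => P t Pt.
  rewrite dotC dot_row_perm dotC.
  exact/le_penalized/penalty_feasible_row_perm.
by move=> Z1 Z2 e; apply/eqP; rewrite eq_le !le.
Qed.

Lemma penalized_dist (D : R) Z : (forall j, rho_ref (A j) - delta j <= D) ->
  `|penalized Z - rho_ref Z| <= D.
Proof.
move=> AD; have D0 : 0 <= D.
  by have := AD j0; rewrite A_j0 delta_j0 (risk_normalized ref_risk) subr0.
have le : penalized Z <= rho_ref Z.
  apply: penalized_le => P t Pt; have := penalty_ge0 Pt.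
  by have := (support_setP C_support P).1 Pt.1 Z; lra.
rewrite distrC ger0_norm ?subr_ge0// lerBlDr -lerBlDl.
rewrite -lee_fin EFinB (support_sup C_support) leeBlDr//.
apply: ge_ereal_sup => _ [P CP <-]; rewrite -EFinD lee_fin -lerBlDr.
apply: le_penalized; split => // j s; rewrite dotC.
have := (support_setP C_support P).1 CP (row_perm s (A j)).
by rewrite (rho_ref_law (law_row_perm _ _)); have := AD j; lra.
Qed.

Lemma penalized_is_rhoF (tau : J -> nat) (S q : forall j, 'cV[R]_(tau j)) :
  (forall j, exists b : 'I_M -> 'I_(tau j), block_map (q j) b) ->
  (forall j, A j = replicate M (q j) (S j)) ->
  is_rhoF C S q delta penalized.
Proof.
move=> hb AE Z tau0 S0 q0 ZS.
have [b bq] := specifies_block_map M_gt0 ZS.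
have -> : penalized Z = penalized (replicate M q0 S0).
  by apply: penalized_law_invariant; rewrite (law_replicate _ M_gt0 bq); exact: ZS.2.
apply/eqP; rewrite eq_le; apply/andP; split; last first.
  apply: ge_ereal_sup => _ [p [v [w [t [[vt dc Cp] ->]]]]].
  rewrite lee_fin -(dot_replicate _ _ M_gt0 bq); apply: le_penalized.
  split => // j s; rewrite AE; have [bj hbj] := hb j.
  move: s; apply/(dual_constraint_row_perm (S j) p (t + delta j) M_gt0 hbj bq).
  by exists (v j), (w j).
rewrite /penalized -ereal_sup_EFin; last 2 first.
- exact: (has_sup_penalized _).2.
- exact: (has_sup_penalized _).1.
apply: ge_ereal_sup => _ [_ [P [t [Pt ->]]] <-].
have [P' [P't P'b P'S]] := penalty_feasible_block_average b Pt.
have [p pE] := block_constant_replicate M_gt0 bq P'b.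
have h j : { v : 'cV[R]_(tau j) & { w : 'cV[R]_tau0 |
    dual_constraint (S j) (q j) p q0 v w /\ total v + total w <= t + delta j} }.
  have [bj hbj] := cid (hb j).
  have /(dual_constraint_row_perm (S j) p _ M_gt0 hbj bq)/cid[v /cid h] :
      forall s : 'S_M, dot (row_perm s (replicate M (q j) (S j)))
        (replicate M q0 (hadamard (lambda_inv M q0) p)) <= t + delta j.
    by move=> s; rewrite pE -AE; exact: P't.2.
  by exists v.
apply: ereal_sup_ubound.
exists p, (fun j => projT1 (h j)), (fun j => sval (projT2 (h j))), t; split.
  split; [move=> j | move=> j | by rewrite /transferred_support/= pE; exact: P't.1].
    exact: (svalP (projT2 (h j))).2.
  exact: (svalP (projT2 (h j))).1.
congr (_ - _)%:E; rewrite -(dot_replicate _ _ M_gt0 bq) pE.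
by rewrite (block_replicate bq) P'S.
Qed.

End Penalized.

Lemma coherent_subadditive (R : realType) M (rho : 'cV[R]_M -> R) (V W : 'cV[R]_M) :
  coherent rho -> rho (V + W) <= rho V + rho W.
Proof.
move=> [[_ _ /convex_functionP cvx _] hom].
have half : 0 <= (2^-1 : R) <= 1 by apply/andP; split; lra.
have := cvx V W _ half I I.
rewrite (_ : 1 - 2^-1 = 2^-1 :> R); last by lra.
by rewrite -scalerDr hom; lra.
Qed.

Lemma coherent_minorant (R : realType) M (rho : 'cV[R]_M -> R) (P : 'cV[R]_M) (K : R) :
  coherent rho -> (forall Z, dot P Z <= rho Z + K) -> forall Z, dot P Z <= rho Z.
Proof.
move=> [_ hom] PK Z; rewrite leNgt; apply/negP => lt.
have d0 : 0 < dot P Z - rho Z by lra.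
pose l := (`|K| + 1) / (dot P Z - rho Z).
have l0 : 0 <= l by rewrite divr_ge0 ?(ltW d0)// addr_ge0.
have := PK (l *: Z); rewrite dotZr hom// -lerBlDl -mulrBr.
rewrite /l divfK ?gt_eqF//; have := ler_norm K; lra.
Qed.

(* The infimal translate [F V = inf_(z in G) rho (V + z) - rho S] is convex,
   vanishes at 0 and inherits the symmetries of rho preserving the blocks; a
   subgradient of F at 0 is one of rho at S and is moreover minimized over G
   at S. *)
Lemma risk_subgradient (R : realType) M tau (rho rho_ref : 'cV[R]_M -> R)
    (C : set 'cV[R]_M) (q S : 'cV[R]_tau) (b : 'I_M -> 'I_tau)
    (G : set 'cV[R]_tau) (d : R) :
  (0 < M)%N -> risk_function rho -> law_invariant rho ->
  coherent rho_ref -> support_set rho_ref C ->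
  (forall V, `|rho V - rho_ref V| <= d) -> block_map q b ->
  (forall x y (l : R), 0 <= l <= 1 -> G x -> G y -> G (l *: x + (1 - l) *: y)) ->
  G S -> (forall z, G z -> rho (replicate M q S) <= rho (replicate M q z)) ->
  exists y, [/\ transferred_support C q y,
    forall V, dot (replicate M q (hadamard (lambda_inv M q) y)) V - dot y S <=
              rho V - rho (replicate M q S) &
    forall z, G z -> dot y S <= dot y z].
Proof.
move=> M0 [rho0 mono /convex_functionP cvx trans] inv coh Csup rd hb Gcvx GS Gmin.
pose rep z := replicate M q z.
have repE z : rep z = \col_i z (b i) 0 by exact: block_replicate.
pose A V := [set rho (V + rep z) | z in G].
have infA V : has_inf (A V).
  split; first by exists (rho (V + rep S)), S.
  exists (rho (rep S) - \sum_i `|V i 0|) => _ [z Gz <-].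
  rewrite (le_trans (lerD (Gmin z Gz) (lexx _)))// -trans; apply: mono => i j.
  rewrite (ord1 j) [leLHS]mxE [leRHS]mxE [const_mx _ _ _]mxE addrC lerD2r.
  rewrite lerNl (le_trans (ler_norm _))// normrN.
  by rewrite (bigD1 i)//= lerDl sumr_ge0.
have infA_le V z : G z -> inf (A V) <= rho (V + rep z).
  by move=> Gz; apply: ge_inf; [exact: (infA V).2 | exists z].
pose F V := inf (A V) - rho (rep S).
have [P0 P0F] : exists P0 : 'cV[R]_M, forall V, dot P0 V <= F V.
  apply: convex_linear_minorant; last first.
    apply/eqP; rewrite subr_eq0 eq_le; apply/andP; split.
      by have := infA_le 0 S GS; rewrite add0r.
    apply: lb_le_inf; first exact: (infA 0).1.
    by move=> _ [z Gz <-]; rewrite add0r; exact: Gmin.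
  apply/convex_functionP => V W l l01 _ _; have /andP[l0 l1] := l01.
  suff : inf (A (l *: V + (1 - l) *: W)) <= l * inf (A V) + (1 - l) * inf (A W).
    by rewrite /F; lra.
  apply/ler_addgt0Pr => e e0.
  have [_ [z Gz <-] /ltW hz] := inf_adherent e0 (infA V).
  have [_ [z' Gz' <-] /ltW hz'] := inf_adherent e0 (infA W).
  apply: le_trans (infA_le _ _ (Gcvx _ _ _ l01 Gz Gz')) _.
  have -> : l *: V + (1 - l) *: W + rep (l *: z + (1 - l) *: z') =
     l *: (V + rep z) + (1 - l) *: (W + rep z').
    by rewrite !repE; apply/matrixP => i j; rewrite !mxE; ring.
  apply: le_trans (cvx _ _ _ l01 I I) _.
  have := ler_wpM2l l0 hz.
  have l1' : 0 <= 1 - l by lra.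
  by have := ler_wpM2l l1' hz'; lra.
have [P [Pb Ple]] := block_average b P0.
have PF V : dot P V <= F V.
  apply: Ple => s sb; apply: le_trans (P0F _) _; rewrite lerD2r.
  apply: lb_le_inf; first exact: (infA V).1.
  move=> _ [z Gz <-]; apply: le_trans (infA_le _ z Gz) _.
  rewrite -(inv _ _ (law_row_perm s (V + rep z))) le_eqVlt; apply/orP; left.
  by apply/eqP; congr rho; apply/matrixP => i j; rewrite !repE !mxE sb.
have Prho V : dot P (V - rep S) <= rho V - rho (rep S).
  apply: le_trans (PF _) _; rewrite lerD2r.
  by have := infA_le (V - rep S) S GS; rewrite subrK.
have [y yP] := block_constant_replicate M0 hb Pb.
have dotE z : dot P (rep z) = dot y z by rewrite -yP (dot_replicate _ _ M0 hb).
exists y; split.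
- rewrite /transferred_support/= yP; apply/(support_setP Csup).
  apply: (@coherent_minorant _ _ _ _ (rho_ref (rep S) + d - rho (rep S))) => // Z.
  have := Prho (Z + rep S); rewrite addrK => /le_trans; apply.
  have := coherent_subadditive Z (rep S) coh.
  by have := rd (Z + rep S); rewrite ler_norml => /andP[_]; lra.
- by move=> V; rewrite yP -dotE -dotBr; exact: Prho.
- move=> z Gz; rewrite -!dotE -subr_le0 -dotBr; apply: le_trans (PF _) _.
  by have := infA_le (rep S - rep z) z Gz; rewrite subrK subr_le0.
Qed.

Section Proposition5.
Context {R : realType} {M n m : nat} {T K J : finType}.
Variables (X : T -> set 'cV[R]_n) (x : T -> 'cV[R]_n).
Variables (Z : 'cV[R]_n -> 'cV[R]_m -> R) (xi : T -> 'I_M -> 'cV[R]_m).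
Variables (L U : K -> 'cV[R]_M) (idx : T -> J) (Xv : J -> 'cV[R]_M).
Variables (tau : J -> nat) (S q : forall j, 'cV[R]_(tau j)).
Variable atom : forall t, 'I_(tau (idx t)) -> 'cV[R]_m.
Variables (rho_ref : 'cV[R]_M -> R) (C : set 'cV[R]_M).
Hypotheses (M_gt0 : (0 < M)%N) (X_convex : forall t, convex_set (X t)).
Hypothesis x_feasible : forall t, X t (x t).
Hypothesis Z_convex : forall t i, convex_function (X t) (fun u => Z u (xi t i)).
Hypothesis idx_inj : injective idx.
Hypothesis Xv_idx : forall t, Xv (idx t) = loss_of Z (xi t) (x t).
Hypothesis Xv_range : range Xv =
  range (fun t => loss_of Z (xi t) (x t)) `|` range L `|` range U `|` [set 0].
Hypothesis F_spec : forall j, specifies (Xv j) (S j) (q j).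
Hypothesis atom_inj : forall t, injective (@atom t).
Hypothesis atom_range : forall t, range (@atom t) = range (xi t).
Hypothesis q_idx :
  forall t o, q (idx t) o 0 = unif_prob [set i | xi t i = @atom t o].
Hypothesis S_idx : forall t o, S (idx t) o 0 = Z (x t) (@atom t o).
Hypotheses (ref_coherent : coherent rho_ref) (ref_law : law_invariant rho_ref).
Hypothesis C_support : support_set rho_ref C.

Let A j := replicate M (q j) (S j).

Let dens j (y : 'cV[R]_(tau j)) := replicate M (q j) (hadamard (lambda_inv M (q j)) y).

Let blocks j : exists b : 'I_M -> 'I_(tau j), block_map (q j) b.
Proof. exact: specifies_block_map (F_spec j). Qed.

Let law_A j : law (A j) = law (Xv j).
Proof. by have [b hb] := blocks j; rewrite (law_replicate _ M_gt0 hb) (F_spec j).2. Qed.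

Lemma law_loss_of t u :
  law (loss_of Z (xi t) u) = law (replicate M (q (idx t)) (\col_o Z u (atom o))).
Proof.
have [b hb] := blocks (idx t).
rewrite (law_replicate _ M_gt0 hb); apply/funext => B.
rewrite /law /dirac_mixture.
have [f fE] : exists f, forall i, xi t i = @atom t (f i).
  have h i : exists o, xi t i = @atom t o.
    have : range (@atom t) (xi t i) by rewrite atom_range; exists i.
    by move=> [a _ <-]; exists a.
  by exists (fun i => sval (cid (h i))) => i; exact: svalP (cid (h i)).
under [RHS]eq_bigr => o _ do rewrite q_idx mxE.
rewrite /unif_prob -sum1_card natr_sum (partition_big f xpredT)//= mulr_suml.
apply: eq_bigr => o _; rewrite mulrAC; congr (_ / _).
rewrite -sum1_card natr_sum mulr_suml big_mkcond [RHS]big_mkcond/=.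
apply: eq_bigr => i _; rewrite !inE /=.
have -> : `[< xi t i = @atom t o >] = (f i == o).
  apply/asboolP/eqP => [|<- //]; rewrite fE; exact: atom_inj.
case: eqP => [<-|_]; last by rewrite andbF.
rewrite andbT mul1r indicE; case: asboolP => /=; rewrite mxE fE => h.
  by rewrite mem_set.
by rewrite memNset.
Qed.

Lemma program_penalized delta y v w :
  program_feasible X Z L U C Xv S q atom delta y v w ->
  [/\ is_rhoF C S q delta (penalized C A delta),
      inverse_feasible X x Z xi L U (penalized C A delta) &
      (sup_dist (penalized C A delta) rho_ref <=
       (program_objective rho_ref Xv delta)%:E)%E].
Proof.
move=> [tot dual supp dec pref norm].
have ref_risk := ref_coherent.1.
have dotA j (z z' : 'cV[R]_(tau j)) : dot (dens z) (replicate M (q j) z') = dot z z'.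
  by have [b hb] := blocks j; exact: dot_replicate hb.
have feas j : penalty_feasible C A delta (dens (y j)) (dot (y j) (S j) - delta j).
  split=> [|i s]; first exact: supp.
  have [bi hbi] := blocks i; have [bj hbj] := blocks j; move: s.
  apply/(dual_constraint_row_perm (S i) (y j) _ M_gt0 hbi hbj).
  by exists (v i j), (w i j); split; [exact: dual | have := tot i j; lra].
have [j0 Xj0] : exists j0, Xv j0 = 0.
  have : range Xv 0 by rewrite Xv_range; right.
  by move=> [j _ <-]; exists j.
have Aj0 : A j0 = 0.
  have [s ->] := law_eq_row_perm M_gt0 (law_A j0).
  by rewrite Xj0; apply/matrixP => i k; rewrite !mxE.
have dj0 := norm _ Xj0.
have P0 : penalty_feasible C A delta (dens (y j0)) 0.
  by have := feas j0; rewrite -dotA -/(A _) Aj0 dot0r dj0 subr0.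
have le := le_penalized C_support Aj0 dj0 P0.
have pen_le := penalized_le C_support Aj0 dj0 P0.
have inv : law_invariant (penalized C A delta).
  exact (penalized_law_invariant M_gt0 ref_law C_support Aj0 dj0 P0).
have rhoX j : penalized C A delta (Xv j) = delta j.
  rewrite -(inv _ _ (law_A j)); apply/eqP; rewrite eq_le; apply/andP; split.
    by apply: pen_le => P t [_ /(_ j 1%g)]; rewrite row_perm1 dotC; lra.
  by have := le _ _ (A j) (feas j); rewrite dotA; lra.
split.
- exact: (penalized_is_rhoF M_gt0 ref_law C_support Aj0 dj0 P0 blocks).
- split => // [|t u Xu|k].
  + exact (penalized_risk_function C_support Aj0 dj0 P0).
  + rewrite -Xv_idx rhoX (inv _ _ (law_loss_of t u)).
    have := le _ _ (replicate M (q (idx t)) (\col_o Z u (atom o))) (feas (idx t)).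
    rewrite dotA; apply: le_trans.
    have : dot (y (idx t)) (S (idx t)) <= dot (y (idx t)) (\col_o Z u (atom o)).
      rewrite -lee_fin; apply: le_trans (dec t) _.
      apply: ereal_inf_lbound; exists u => //; congr (_%:E).
      by apply: eq_bigr => o _; rewrite mxE.
    by lra.
  + have [i _ Li] : range Xv (L k) by rewrite Xv_range; left; left; right; exists k.
    have [j _ Uj] : range Xv (U k) by rewrite Xv_range; left; right; exists k.
    by rewrite -Li -Uj !rhoX; apply: pref; exists k.
- apply: ge_ereal_sup => _ [V _ <-]; rewrite lee_fin.
  apply: (penalized_dist ref_law C_support ref_risk Aj0 dj0 P0) => j.
  rewrite (ref_law (law_A j)) (le_trans (ler_norm _))// distrC.
  exact: le_bigmax.
Qed.

Lemma inverse_program rho :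
  inverse_feasible X x Z xi L U rho -> (sup_dist rho rho_ref < +oo)%E ->
  exists delta y v w, program_feasible X Z L U C Xv S q atom delta y v w /\
    ((program_objective rho_ref Xv delta)%:E <= sup_dist rho rho_ref)%E.
Proof.
move=> [risk inv opt LU] fin.
have le_dist V : (`|rho V - rho_ref V|%:E <= sup_dist rho rho_ref)%E.
  by apply: ereal_sup_ubound; exists V.
have [d dE] : exists d, sup_dist rho rho_ref = d%:E.
  have : (0 <= sup_dist rho rho_ref)%E by apply: le_trans (le_dist 0); rewrite lee_fin.
  by move: fin; case: (sup_dist _ _) => // d _ _; exists d.
have rd V : `|rho V - rho_ref V| <= d by rewrite -lee_fin -dE.
have rhoA j : rho (A j) = rho (Xv j) by apply: inv; exact: law_A.
have sub j : exists y : 'cV[R]_(tau j), [/\ transferred_support C (q j) y,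
    forall V, dot (dens y) V - dot y (S j) <= rho V - rho (A j) &
    forall t (e : j = idx t) u, X t u -> dot y (S j) <=
      \sum_o ecast k 'cV[R]_(tau k) e y o 0 * Z u (@atom t o)].
  have [b hb] := blocks j.
  have [[t e]|nt] := pselect (exists t, j = idx t); last first.
    have [|//||y [yC yV _]] := @risk_subgradient _ _ _ rho rho_ref C (q j) (S j) b
      [set S j] d M_gt0 risk inv ref_coherent C_support rd hb.
    - by move=> _ _ l _ -> ->; rewrite /= -scalerDl addrC subrK scale1r.
    - by move=> _ ->.
    - by exists y; split => // t e; case: nt; exists t.
  subst j.
  pose G := [set z : 'cV[R]_(tau (idx t)) |
    exists2 u, X t u & forall o, Z u (@atom t o) <= z o 0].
  have atom_xi o : exists i, xi t i = @atom t o.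
    have : range (xi t) (@atom t o) by rewrite -atom_range; exists o.
    by move=> [i _ <-]; exists i.
  have [|||y [yC yV yG]] := @risk_subgradient _ _ _ rho rho_ref C _ (S (idx t)) b
    G d M_gt0 risk inv ref_coherent C_support rd hb.
  - move=> z z' l l01 [u Xu zu] [u' Xu' zu']; have /andP[l0 l1] := l01.
    exists (l *: u + (1 - l) *: u').
      by move/convex_setP: (@X_convex t); apply.
    move=> o; have [i iE] := atom_xi o; rewrite -iE.
    have /convex_functionP/(_ u u' l l01 Xu Xu')/= h := @Z_convex t i.
    apply: le_trans h _; rewrite !mxE iE.
    have l1' : 0 <= 1 - l by lra.
    have := ler_wpM2l l0 (zu o); have := ler_wpM2l l1' (zu' o); lra.
  - by exists (x t) => // o; rewrite S_idx.
  - move=> z [u Xu zu]; rewrite -/(A _) rhoA Xv_idx (le_trans (opt t u Xu))//.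
    rewrite (inv _ _ (law_loss_of t u)); apply: risk_monotone => // i k.
    by rewrite !(block_replicate hb) !mxE.
  - exists y; split => // t' e u; have tt := idx_inj e; subst t'.
    rewrite (eq_irrelevance e erefl) /= => Xu.
    rewrite (_ : \sum_o _ = dot y (\col_o Z u (atom o))).
      by apply: yG; exists u => // o; rewrite mxE.
    by apply: eq_bigr => o _; rewrite mxE.
have [y [yC yA yX]] : exists y : forall j, 'cV[R]_(tau j), [/\
    forall j, transferred_support C (q j) (y j),
    forall j V, dot (dens (y j)) V - dot (y j) (S j) <= rho V - rho (A j) &
    forall t u, X t u ->
      dot (y (idx t)) (S (idx t)) <= \sum_o y (idx t) o 0 * Z u (@atom t o)].
  exists (fun j => sval (cid (sub j))); split=> [j|j|t].
  - by have [] := svalP (cid (sub j)).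
  - by have [] := svalP (cid (sub j)).
  - by have [_ _ /(_ t erefl)] := svalP (cid (sub (idx t))).
have h i j : {v : 'cV[R]_(tau i) & {w : 'cV[R]_(tau j) |
    dual_constraint (S i) (q i) (y j) (q j) v w /\
    total v + total w <= rho (Xv i) - rho (Xv j) + dot (y j) (S j)}}.
  have [bi hbi] := cid (blocks i); have [bj hbj] := cid (blocks j).
  have /(dual_constraint_row_perm _ _ _ M_gt0 hbi hbj)/cid[v /cid h] :
      forall s : 'S_M, dot (row_perm s (A i)) (dens (y j)) <=
        rho (Xv i) - rho (Xv j) + dot (y j) (S j).
    move=> s; have := yA j (row_perm s (A i)).
    by rewrite (inv _ _ (law_row_perm s (A i))) !rhoA dotC; lra.
  by exists v.
exists (fun j => rho (Xv j)), y, (fun i j => projT1 (h i j)),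
  (fun i j => sval (projT2 (h i j))); split.
  split=> [i j|i j|j|t|i j [k [-> ->]]|j ->].
  - exact: (svalP (projT2 (h i j))).2.
  - exact: (svalP (projT2 (h i j))).1.
  - exact: yC.
  - apply: le_ereal_inf_tmp => _ [u Xu <-]; rewrite lee_fin.
    exact: yX.
  - exact: LU.
  - exact: risk_normalized.
rewrite dE lee_fin; apply: bigmax_le => [|j _]; last exact: rd.
exact: le_trans (rd 0).
Qed.

End Proposition5.

Theorem proposition5 (R : realType) (M n m : nat) (M_gt0 : (0 < M)%N)
    (T K : finType)
    (X : T -> set 'cV[R]_n) (X_convex : forall t, convex_set (X t))
    (x : T -> 'cV[R]_n) (x_feasible : forall t, X t (x t))
    (Z : 'cV[R]_n -> 'cV[R]_m -> R) (xi : T -> 'I_M -> 'cV[R]_m)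
    (Z_convex : forall t i, convex_function (X t) (fun u => Z u (xi t i)))
    (L U : K -> 'cV[R]_M)
    (* the family (X_j)_(j in J), with T embedded in J by idx *)
    (J : finType) (idx : T -> J) (idx_inj : injective idx)
    (Xv : J -> 'cV[R]_M)
    (Xv_idx : forall t, Xv (idx t) = loss_of Z (xi t) (x t))
    (Xv_range : range Xv =
       range (fun t => loss_of Z (xi t) (x t)) `|` range L `|` range U `|` [set 0])
    (* the distributions F_j *)
    (tau : J -> nat) (S q : forall j, 'cV[R]_(tau j))
    (F_spec : forall j, specifies (Xv j) (S j) (q j))
    (* the support of xi^t and its probabilities *)
    (atom : forall t, 'I_(tau (idx t)) -> 'cV[R]_m)
    (atom_inj : forall t, injective (@atom t))
    (atom_range : forall t, range (@atom t) = range (xi t))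
    (q_idx : forall t o, q (idx t) o 0 = unif_prob [set i | xi t i = @atom t o])
    (S_idx : forall t o, S (idx t) o 0 = Z (x t) (@atom t o))
    (* the reference risk measure and its support set *)
    (rho_ref : 'cV[R]_M -> R) (rho_ref_coherent : coherent rho_ref)
    (rho_ref_law : law_invariant rho_ref)
    (C : set 'cV[R]_M) (C_support : support_set rho_ref C)
    (solvable : exists rho, inverse_optimal X x Z xi L U rho_ref rho) :
  [/\ (forall (Y : 'cV[R]_M) (tau0 : nat) (S0 q0 : 'cV[R]_tau0),
         specifies Y S0 q0 ->
         forall y, transferred_support C q0 y -> forall o, 0 <= y o 0),
      (exists delta y v w,
         program_optimal X Z L U rho_ref C Xv S q atom delta y v w)
    & (forall delta y v w,
         program_optimal X Z L U rho_ref C Xv S q atom delta y v w ->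
         exists rho, is_rhoF C S q delta rho /\
                     inverse_optimal X x Z xi L U rho_ref rho)].

Proof.
split.
- move=> Y tau0 S0 q0 YS y Cy o.
  have [b hb] := specifies_block_map M_gt0 YS.
  have q0' : 0 < q0 o 0 * M%:R by rewrite mulr_gt0 ?ltr0n// (block_gt0 hb).
  have [i bi] : exists i, b i = o.
    have : 0 < #|[set i | b i == o]%SET|%:R :> R by rewrite (block_card hb).
    rewrite ltr0n card_gt0 => /set0Pn[i]; rewrite inE => /eqP <-.
    by exists i.
  have := (support_simplex C_support Cy).2 i.
  by rewrite (block_replicate hb) !mxE bi pmulr_rge0// invr_gt0.
- have [rho [rho_feas rho_fin rho_min]] := solvable.
  have [delta [y [v [w [feas obj]]]]] := inverse_program M_gt0 X_convex x_feasible
    Z_convex idx_inj Xv_idx F_spec atom_inj atom_range q_idx S_idx rho_ref_coherent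
    C_support rho_feas rho_fin.
  exists delta, y, v, w; split => // delta' y' v' w' feas'.
  have [_ /rho_min rho_le dist_le] := program_penalized M_gt0 Xv_idx Xv_range F_spec
    atom_inj atom_range q_idx rho_ref_coherent rho_ref_law C_support feas'.
  by rewrite -lee_fin (le_trans obj)// (le_trans rho_le).
- move=> delta y v w [feas opt].
  have [is_rho rho_feas dist_le] := program_penalized M_gt0 Xv_idx Xv_range F_spec
    atom_inj atom_range q_idx rho_ref_coherent rho_ref_law C_support feas.
  eexists; split; first exact: is_rho.
  split => // [|rho' rho'_feas]; first exact: le_lt_trans dist_le (ltry _).
  have [->|rho'_fin] := eqVneq (sup_dist rho' rho_ref) +oo%E; first exact: leey.
  have fin : (sup_dist rho' rho_ref < +oo)%E by rewrite ltey.
  have [delta' [y' [v' [w' [feas' obj']]]]] := inverse_program M_gt0 X_convex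
    x_feasible Z_convex idx_inj Xv_idx F_spec atom_inj atom_range q_idx S_idx
    rho_ref_coherent C_support rho'_feas fin.
  apply: le_trans dist_le _; apply: le_trans obj'.
  by rewrite lee_fin; exact: opt feas'.
Qed.
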